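(* Let $\mathbb{G}=(\Gamma,\mathcal{G})$ be a graph of groups and $v\in V(\Gamma)$ a base vertex. Suppose that there exists an edge $e\in E(\Gamma)$ such that $|\Sigma_e|=[G_{o(e)}:\alpha_e(G_e)]=\infty$ and $|\Sigma_{\bar e}|\geq2$. Suppose that for any finite $F\subset G_{o(e)}$ and finite $E\subset\Sigma_e$ there exists a $g\in\Sigma_e\setminus E$ such that $Fg\cap\alpha_e(G_e)=\emptyset$ and $g^{-1}(F\setminus\{1_{o(e)}\})g\cap\alpha_e(G_e)=\emptyset$. Then $\pi_1(\mathbb{G},v)\curvearrowright X_{\mathbb{G}}$ is strongly faithful.
   Context: A graph $\Gamma$ has a vertex set $V(\Gamma)$, a set $E(\Gamma)$ of oriented edges, maps $o,t:E(\Gamma)\to V(\Gamma)$ and an involution $e\mapsto\bar e$ with $\bar e\ne e$ and $o(e)=t(\bar e)$. A graph of groups $\mathbb{G}=(\Gamma,\mathcal{G})$ is a connected graph $\Gamma$ with vertex groups $G_v$, edge groups $G_e=G_{\bar e}$, and monomorphisms $\alpha_e:G_e\hookrightarrow G_{o(e)}$; $\Gamma$ is countable and all groups are countable discrete. For each $e$, $\Sigma_e\subset G_{o(e)}$ is a fixed set of representatives of the left cosets $G_{o(e)}/\alpha_e(G_e)$ containing the identity $1_{o(e)}$. The path group $F(\mathbb{G})$ is generated by all $G_v$ and all $e\in E(\Gamma)$ subject to $\bar e=e^{-1}$ and $\bar e\,\alpha_e(g)\,e=\alpha_{\bar e}(g)$ for $g\in G_e$. $\pi[v,u]\subset F(\mathbb{G})$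 is the set of elements $g_1e_1\cdots g_ne_ng_{n+1}$ ($n\ge 0$) with $(e_1,\dots,e_n)$ an edge path from $v$ to $u$, $g_i\in G_{o(e_i)}$, $g_{n+1}\in G_u$; $\pi_1(\mathbb{G},v)=\pi[v,v]$. The Bass–Serre tree $X_{\mathbb{G}}$ has vertices the cosets $\gamma G_u$, $\gamma\in\pi[v,u]$, $u\in V(\Gamma)$; $\gamma_1G_{u_1}$, $\gamma_2G_{u_2}$ are joined by an edge iff $\gamma_1^{-1}\gamma_2\in G_{u_1}eG_{u_2}$ for some $e$ with $o(e)=u_1$, $t(e)=u_2$; $\pi_1(\mathbb{G},v)$ acts by left multiplication. An action $G\curvearrowright S$ on a set $S$ is strongly faithful if for any finite $F\subset G\setminus\{1_G\}$ there is $x\in S$ with $g\cdot x\ne x$ for all $g\in F$. For an action on a tree, $S$ is the vertex set. *)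

(* Defs.v *)
From HB Require Import structures.
From mathcomp Require Import all_boot.
From mathcomp Require Import mathcomp_extra boolp classical_sets functions
  cardinality.

Set Implicit Arguments.
Unset Strict Implicit.
Unset Printing Implicit Defensive.

Local Open Scope classical_set_scope.
Local Open Scope group_scope.

(* Here, "countable" includes "finite": [countType] for the graph, and
   [countable] of the library for the groups. *)
Record graph := Graph {
  vertex : countType;
  edge : countType;
  org : edge -> vertex;
  tgt : edge -> vertex;
  rev_edge : edge -> edge;
  rev_edgeK : involutive rev_edge;
  rev_edge_neq : forall e, rev_edge e <> e;
  org_rev : forall e, org e = tgt (rev_edge e) }.

Fixpoint edge_path (Gm : graph) (v u : vertex Gm) (s : seq (edge Gm)) : bool :=
  if s is e :: s' then (org e == v) && edge_path (tgt e) u s' else v == u.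

Definition connected_graph (Gm : graph) : Prop :=
  forall v u : vertex Gm, exists s, edge_path v u s.

Record graph_of_groups := GraphOfGroups {
  base_graph :> graph;
  base_connected : connected_graph base_graph;
  vgroup : vertex base_graph -> groupType;
  egroup : edge base_graph -> groupType;
  vgroup_countable : forall v, countable [set: vgroup v];
  egroup_countable : forall e, countable [set: egroup e];
  egroup_rev : forall e, egroup (rev_edge e) = egroup e;
  emb : forall e, UMagmaMorphism.type (egroup e) (vgroup (org e));
  emb_inj : forall e, injective (emb e) }.

Section PathGroup.
Variable GG : graph_of_groups.
Implicit Types (v u : vertex GG) (e : edge GG).

(* The identity of G_e = G_(rev e), seen through [egroup_rev]. *)
Definition egroup_cast e (g : egroup e) : egroup (rev_edge e) :=
  eq_rect_r (fun H : groupType => H : Type) g (egroup_rev e).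

Inductive generator : Type :=
  | VGen v of vgroup v
  | EGen of edge GG.

HB.instance Definition _ := gen_eqMixin generator.
HB.instance Definition _ := gen_choiceMixin generator.

Definition word := seq generator.

(* The presentation of the path group, as a monoid: formal inverses of the
   generators are not needed, since the inverse of [VGen g] is [VGen g^-1] and
   that of [EGen e] is [EGen (rev_edge e)]. *)
Inductive word_eqv : word -> word -> Prop :=
  | weqv_refl w : word_eqv w w
  | weqv_sym w1 w2 : word_eqv w1 w2 -> word_eqv w2 w1
  | weqv_trans w1 w2 w3 : word_eqv w1 w2 -> word_eqv w2 w3 -> word_eqv w1 w3
  | weqv_cat w1 w1' w2 w2' : word_eqv w1 w1' -> word_eqv w2 w2' ->
      word_eqv (w1 ++ w2) (w1' ++ w2')
  | weqv_one v : word_eqv [:: VGen (1 : vgroup v)] [::]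
  | weqv_mul v (g h : vgroup v) : word_eqv [:: VGen g; VGen h] [:: VGen (g * h)]
  | weqv_rev e : word_eqv [:: EGen e; EGen (rev_edge e)] [::]
  | weqv_edge e (g : egroup e) :
      word_eqv [:: EGen (rev_edge e); VGen (emb e g); EGen e]
               [:: VGen (emb (rev_edge e) (egroup_cast g))].

Definition word_eqb : rel word := fun w1 w2 => `[< word_eqv w1 w2 >].

Lemma word_eqb_equiv : equiv_class_of word_eqb.
Proof.
split=> [w|w1 w2|w2 w1 w3].
- by apply/asboolP; exact: weqv_refl.
- by apply/asboolP/asboolP => ?; exact: weqv_sym.
- by move=> /asboolP h1 /asboolP h2; apply/asboolP; exact: weqv_trans h1 h2.
Qed.

Canonical word_equiv : equiv_rel word := EquivRelPack word_eqb_equiv.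

Definition path_group := {eq_quot word_equiv}%qT.

HB.instance Definition _ := Choice.on path_group.
HB.instance Definition _ := EqQuotient.on path_group.

Definition inv_gen (x : generator) : generator :=
  match x with VGen _ g => VGen g^-1 | EGen e => EGen (rev_edge e) end.

Definition inv_word (w : word) : word := [seq inv_gen x | x <- rev w].

Definition path_class (w : word) : path_group := \pi_path_group%qT w.

Definition path_one : path_group := path_class [::].
Definition path_mul (x y : path_group) : path_group :=
  path_class (repr x ++ repr y).
Definition path_inv (x : path_group) : path_group :=
  path_class (inv_word (repr x)).

Lemma path_classP w1 w2 : path_class w1 = path_class w2 <-> word_eqv w1 w2.
Proof.
split=> [/eqquotP/asboolP//|h]; apply/eqquotP.
exact/asboolP.
Qed.

Lemma repr_path_class w : word_eqv (repr (path_class w)) w.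
Proof. by apply/path_classP; rewrite /path_class reprK. Qed.

Lemma path_class_repr x : path_class (repr x) = x.
Proof. exact: reprK. Qed.

Lemma path_mulE w1 w2 :
  path_mul (path_class w1) (path_class w2) = path_class (w1 ++ w2).
Proof. by apply/path_classP/weqv_cat; exact: repr_path_class. Qed.

Lemma inv_word_cat w1 w2 : inv_word (w1 ++ w2) = inv_word w2 ++ inv_word w1.
Proof. by rewrite /inv_word rev_cat map_cat. Qed.

Lemma weqv_mulV w : word_eqv (w ++ inv_word w) [::].
Proof.
elim: w => [|x w IH]; first exact: weqv_refl.
rewrite -cat1s inv_word_cat -catA.
apply: (weqv_trans (w2 := [:: x] ++ inv_word [:: x])).
  apply: weqv_cat (weqv_refl _) _; rewrite catA -[X in word_eqv _ X]cat0s.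
  exact: weqv_cat IH (weqv_refl _).
case: x => [v g|e]; last exact: weqv_rev.
by apply: weqv_trans (weqv_mul _ _) _; rewrite mulgV; exact: weqv_one.
Qed.

Lemma weqv_mulVl w : word_eqv (inv_word w ++ w) [::].
Proof.
suff invK : inv_word (inv_word w) = w.
  by rewrite -{2}invK; exact: weqv_mulV.
rewrite /inv_word -map_rev revK -map_comp map_id_in// => -[v g|e] _ /=.
  by rewrite invgK.
by rewrite rev_edgeK.
Qed.

Lemma path_mulA : associative path_mul.
Proof.
move=> x y z; rewrite -(path_class_repr x) -(path_class_repr y).
by rewrite -(path_class_repr z) !path_mulE catA.
Qed.

Lemma path_mul1 : left_id path_one path_mul.
Proof. by move=> x; rewrite -(path_class_repr x) path_mulE. Qed.

Lemma path_mul1r : right_id path_one path_mul.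
Proof. by move=> x; rewrite -(path_class_repr x) path_mulE cats0. Qed.

Lemma path_mulV : left_inverse path_one path_inv path_mul.
Proof.
move=> x; rewrite -[in RHS]/path_one -{2}(path_class_repr x) path_mulE.
exact/path_classP/weqv_mulVl.
Qed.

Lemma path_mulVr : right_inverse path_one path_inv path_mul.
Proof.
move=> x; rewrite -{1}(path_class_repr x) path_mulE.
exact/path_classP/weqv_mulV.
Qed.

HB.instance Definition _ := isGroup.Build path_group
  path_mulA path_mul1 path_mul1r path_mulV path_mulVr.

Definition vtx v (g : vgroup v) : path_group := path_class [:: VGen g].
Definition edg e : path_group := path_class [:: EGen e].

Lemma vtxM v (g h : vgroup v) : vtx (g * h) = vtx g * vtx h.
Proof. by rewrite [RHS]path_mulE; apply/path_classP/weqv_sym/weqv_mul. Qed.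

Lemma vtx1 v : vtx (1 : vgroup v) = 1.
Proof. exact/path_classP/weqv_one. Qed.

Lemma vtxV v (g : vgroup v) : vtx g^-1 = (vtx g)^-1.
Proof. by apply: (mulgI (vtx g)); rewrite mulgV -vtxM mulgV vtx1. Qed.

Lemma edgV e : edg (rev_edge e) = (edg e)^-1.
Proof.
apply: (mulgI (edg e)); rewrite mulgV [LHS]path_mulE.
exact/path_classP/weqv_rev.
Qed.

Lemma edg_rel e (g : egroup e) :
  edg (rev_edge e) * vtx (emb e g) * edg e =
  vtx (emb (rev_edge e) (egroup_cast g)).
Proof.
rewrite [X in X * _]path_mulE [LHS]path_mulE.
exact/path_classP/weqv_edge.
Qed.

(* pi[v, u]: the item [Tagged _ g_i] of [s], with tag e_i and g_i in G_(o e_i),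
   stands for g_i e_i. *)
Definition path_set v u : set path_group :=
  [set x | exists (s : seq {e : edge GG & vgroup (org e)}) (g : vgroup u),
     edge_path v u [seq tag p | p <- s] /\
     x = (\prod_(p <- s) (vtx (tagged p) * edg (tag p))) * vtx g].

Lemma path_set_vtx v (g : vgroup v) : path_set v v (vtx g).
Proof. by exists [::], g; split => //=; rewrite big_nil mul1g. Qed.

Lemma path_set1 v : path_set v v 1.
Proof. by rewrite -(vtx1 v); exact: path_set_vtx. Qed.

Lemma path_set_cons e u (g : vgroup (org e)) x :
  path_set (tgt e) u x -> path_set (org e) u (vtx g * edg e * x).
Proof.
move=> [s [h [ps ->]]]; exists (Tagged (fun e => vgroup (org e)) g :: s), h.
by split; [rewrite /= eqxx|rewrite big_cons !mulgA].
Qed.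

Lemma path_set_edg e : path_set (org e) (tgt e) (edg e).
Proof.
rewrite -[edg e]mul1g -(vtx1 (org e)) -[X in path_set _ _ X]mulg1.
exact/path_set_cons/path_set1.
Qed.

Lemma path_set_ind (P : forall v u, path_group -> Prop) :
  (forall v (g : vgroup v), P v v (vtx g)) ->
  (forall e u (g : vgroup (org e)) x, path_set (tgt e) u x ->
     P (tgt e) u x -> P (org e) u (vtx g * edg e * x)) ->
  forall v u x, path_set v u x -> P v u x.
Proof.
move=> P0 PS v u x [s [g [ps ->]]].
elim: s v ps => [|[e h] s IH] v /=.
  by move=> /eqP ->; rewrite big_nil mul1g.
move=> /andP[/eqP <- ps]; rewrite big_cons -mulgA /=.
by apply: PS; [exists s, g|exact: IH].
Qed.

Lemma path_set_vtxl v u (g : vgroup v) x :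
  path_set v u x -> path_set v u (vtx g * x).
Proof.
move=> px; elim/path_set_ind: v u x / px g => [v h|e u h x px _] g.
  by rewrite -vtxM; exact: path_set_vtx.
by rewrite 2!mulgA -vtxM; exact: path_set_cons.
Qed.

Lemma path_setM v u w x y :
  path_set v u x -> path_set u w y -> path_set v w (x * y).
Proof.
move=> px; elim/path_set_ind: v u x / px => [v h|e u h x px IH].
  exact: path_set_vtxl.
by move=> /IH py; rewrite -mulgA; exact: path_set_cons.
Qed.

Lemma path_setV v u x : path_set v u x -> path_set u v x^-1.
Proof.
move=> px; elim/path_set_ind: v u x / px => [v g|e u g x _ IH].
  by rewrite -vtxV; exact: path_set_vtx.
rewrite 2!invgM; apply: path_setM IH _.
rewrite -vtxV -edgV; have := path_set_edg (rev_edge e).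
rewrite -org_rev org_rev rev_edgeK => pe.
by apply: path_setM pe _; exact: path_set_vtx.
Qed.

End PathGroup.

Definition pi1 (GG : graph_of_groups) (v : vertex GG) :=
  {x : path_group GG | x \in path_set v v}.

Section FundamentalGroup.
Variables (GG : graph_of_groups) (v : vertex GG).

HB.instance Definition _ := SubChoice.on (pi1 v).

Lemma path_set_group_closed :
  group_closed [pred x : path_group GG | x \in path_set v v].
Proof.
split=> [|x y]; rewrite !inE; first exact: path_set1.
by move=> px py; apply: path_setM px _; exact: path_setV.
Qed.

HB.instance Definition _ := SubChoice_isSubGroup.Build (path_group GG)
  _ (pi1 v) path_set_group_closed.

End FundamentalGroup.

Record group_action (G : groupType) (S : Type) := GroupAction {
  gact :> G -> S -> S;
  gact1 : forall x, gact 1 x = x;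
  gactM : forall g h x, gact (g * h) x = gact g (gact h x) }.

Definition strongly_faithful (G : groupType) (S : Type)
    (a : group_action G S) : Prop :=
  forall F : set G, finite_set F -> F `<=` [set~ 1] ->
    exists x : S, forall g, F g -> a g x <> x.

Section BassSerreTree.
Variables (GG : graph_of_groups) (v : vertex GG).

Definition vtx_coset (u : vertex GG) (x : path_group GG) : set (path_group GG) :=
  [set x * vtx g | g in [set: vgroup u]].

Record bs_vertex := BSVertex {
  bs_type : vertex GG;
  bs_coset : set (path_group GG);
  bs_cosetP : exists2 x, path_set v bs_type x & bs_coset = vtx_coset bs_type x }.

Definition bs_adj (X Y : bs_vertex) : Prop :=
  exists x y : path_group GG,
    [/\ path_set v (bs_type X) x, bs_coset X = vtx_coset (bs_type X) x,
        path_set v (bs_type Y) y, bs_coset Y = vtx_coset (bs_type Y) y &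
        exists (e : edge GG) (g : vgroup (bs_type X)) (h : vgroup (bs_type Y)),
          [/\ org e = bs_type X, tgt e = bs_type Y &
              x^-1 * y = vtx g * edg e * vtx h]].

Lemma vtx_cosetM (u : vertex GG) (x y : path_group GG) :
  [set x * z | z in vtx_coset u y] = vtx_coset u (x * y).
Proof.
apply/seteqP; split=> z.
  by move=> [_ [g _ <-] <-]; exists g => //; rewrite mulgA.
by move=> [g _ <-]; exists (y * vtx g); [exists g|rewrite mulgA].
Qed.

Lemma bs_act_subproof (g : pi1 v) (X : bs_vertex) :
  exists2 x, path_set v (bs_type X) x &
    [set val g * y | y in bs_coset X] = vtx_coset (bs_type X) x.
Proof.
have [x px ->] := bs_cosetP X; exists (val g * x); last exact: vtx_cosetM.
by apply: path_setM px; have := valP g; rewrite inE.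
Qed.

Definition bs_act (g : pi1 v) (X : bs_vertex) : bs_vertex :=
  BSVertex (bs_act_subproof g X).

Lemma bs_vertex_eq (X Y : bs_vertex) :
  bs_type X = bs_type Y -> bs_coset X = bs_coset Y -> X = Y.
Proof.
case: X Y => [u C p] [u' C' p'] /= eu eC; case: u' / eu p' => p'.
by case: C' / eC p' => p'; rewrite (Prop_irrelevance p p').
Qed.

Lemma bs_act1 X : bs_act 1 X = X.
Proof.
apply: bs_vertex_eq => //=; have [x _ ->] := bs_cosetP X.
by rewrite vtx_cosetM mul1g.
Qed.

Lemma bs_actM g h X : bs_act (g * h) X = bs_act g (bs_act h X).
Proof.
apply: bs_vertex_eq => //=; have [x _ ->] := bs_cosetP X.
by rewrite !vtx_cosetM mulgA.
Qed.

Lemma bs_act_adj g X Y : bs_adj X Y -> bs_adj (bs_act g X) (bs_act g Y).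
Proof.
move=> [x [y [px eX py eY xy]]].
have pg : path_set v v (val g) by have := valP g; rewrite inE.
exists (val g * x), (val g * y); split=> /=.
- exact: path_setM px.
- by rewrite eX vtx_cosetM.
- exact: path_setM py.
- by rewrite eY vtx_cosetM.
- by rewrite invgM -mulgA mulKg.
Qed.

(* Strong faithfulness of an action on a tree is about its vertex set, so the
   edge relation [bs_adj] only enters through [bs_act_adj]. *)
Definition bs_action : group_action (pi1 v) bs_vertex :=
  GroupAction bs_act1 bs_actM.

End BassSerreTree.

(* S contains 1 and exactly one element of each left coset x H, where H is the
   image of the edge group in the group of its origin. *)
Definition edge_transversal (GG : graph_of_groups) (e : edge GG)
    (S : set (vgroup (org e))) : Prop :=
  S 1 /\ forall x : vgroup (org e),
    exists! s, S s /\ range (emb e) (s^-1 * x).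

(* Main.v *)
Require Import Defs.
From HB Require Import structures.
From mathcomp Require Import all_boot.
From mathcomp Require Import boolp classical_sets functions cardinality.

Set Implicit Arguments.
Unset Strict Implicit.
Unset Printing Implicit Defensive.

Local Open Scope classical_set_scope.
Local Open Scope group_scope.

(** The vertex that is moved is found explicitly. Conjugation by a path from v
to o(e) reduces everything to finitely many nontrivial elements x of
pi_1(GG, o(e)). Write each of them as a reduced path h_1 e_1 ... e_n h_(n+1).
For g in G_o(e), the path
  (g e)^-1 x (g e) = rev(e) (g^-1 h_1) e_1 ... e_n (h_(n+1) g) e
is again reduced unless
- n = 0 and g^-1 h_1 g lies in the image of G_e, or
- n > 0 and h_(n+1) g or h_1^-1 g lies in that image.
The last condition matters only if e_1 = e. The hypothesis on Sigma_e, applied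
to the finite set of all h_(n+1) and, for paths that begin with e, of all
h_1^-1, gives a g that avoids these cases for all x at once
([finite_conj_obstruction]). A reduced path with an edge in it never represents
an element of a vertex group ([conj_path_not_vtx]), so no x fixes the vertex
g e G_t(e).

This last fact, the normal form theorem for graphs of groups, has to be derived
from the presentation of the path group. The vertex groups all embed in their
product K, and their edge subgroups become subgroups of K, identified in pairs
by partial isomorphisms. So the path group maps to the multiple HNN extension
of K with the edges as stable letters, and reduced paths remain reduced there.
Working over the single group K removes all dependence of types on vertices.
Following van der Waerden, K and the stable letters act on the set of normal
forms of this HNN extension; the defining relations of the path group hold for
this action ([word_act_eqv]). A reduced path that begins with g_1 e_1 sends a
normal form without stable letters to one that begins with e_1
([reduced_act]), which no element of K does. *)

(** * Normal forms of a multiple HNN extension *)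

(** The stable letters e and bar e are inverse to each other, and satisfy
a e = e (assoc_iso e a) for a in the associated subgroup assoc e. That
assoc_iso e is a total function avoids subtypes. *)
Record hnn_data (K : groupType) (E : eqType) := HnnData {
  bar : E -> E;
  assoc : E -> set K;
  assoc_iso : E -> K -> K;
  barK : involutive bar;
  assoc1 : forall e, assoc e 1;
  assocM : forall e a b, assoc e a -> assoc e b -> assoc e (a * b);
  assocV : forall e a, assoc e a -> assoc e a^-1;
  assoc_iso_mem : forall e a, assoc e a -> assoc (bar e) (assoc_iso e a);
  assoc_isoM : forall e a b, assoc e a -> assoc e b ->
    assoc_iso e (a * b) = assoc_iso e a * assoc_iso e b;
  assoc_isoK : forall e a, assoc e a ->
    assoc_iso (bar e) (assoc_iso e a) = a }.

Section NormalForms.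
Variables (K : groupType) (E : eqType) (H : hnn_data K E).
Implicit Types (e f : E) (a g k : K).
Local Notation bar := (bar H).
Local Notation A := (assoc H).
Local Notation theta := (assoc_iso H).

(** Choosing 1 in A_e itself makes membership in A_e visible as a trivial
representative ([coset_rep_eq1]). *)
Definition coset_rep e k : K :=
  if `[< A e k >] then 1 else xget 1 [set r | A e (r^-1 * k)].

Lemma coset_rep_mem e k : A e ((coset_rep e k)^-1 * k).
Proof.
rewrite /coset_rep; case: asboolP => [Ak|_]; first by rewrite invg1 mul1g.
apply: (@xgetPex _ 1 [set r | A e (r^-1 * k)]); exists k => /=.
by rewrite mulVg; exact: assoc1.
Qed.

Lemma subgroup_mulr e k a : A e a -> A e (k * a) <-> A e k.
Proof.
move=> Aa; split=> [Aka|Ak]; last exact: assocM.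
by rewrite -(mulgK a k); apply: assocM => //; exact: assocV.
Qed.

Lemma coset_rep_eq1 e k : coset_rep e k = 1 <-> A e k.
Proof.
split=> [r1|Ak]; last by rewrite /coset_rep asboolT.
by have := coset_rep_mem e k; rewrite r1 invg1 mul1g.
Qed.

(** The two cosets are equal as sets, hence the same choice is made in both. *)
Lemma coset_repMr e k a : A e a -> coset_rep e (k * a) = coset_rep e k.
Proof.
move=> Aa; rewrite /coset_rep.
have -> : `[< A e (k * a) >] = `[< A e k >].
  exact/asbool_equiv_eq/subgroup_mulr.
congr (if _ then _ else xget _ _); apply/seteqP.
by split=> r /=; rewrite mulgA => /(subgroup_mulr _ Aa).
Qed.

Lemma coset_rep_idem_mul e g k :
  coset_rep e (g * coset_rep e k) = coset_rep e (g * k).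
Proof.
by rewrite -(coset_repMr _ (coset_rep_mem e k)) -mulgA mulVKg.
Qed.

Lemma assoc_iso1 e : theta e 1 = 1.
Proof.
have A1 := assoc1 H e.
by apply: (mulgI (theta e 1)); rewrite -assoc_isoM// !mulg1.
Qed.

(** [Syl k_1 e_1 (... (Syl k_n e_n (Base k)))] stands for the product
k_1 e_1 ... k_n e_n k. *)
Inductive nform : Type :=
  | Base of K
  | Syl of K & E & nform.

Definition starts_with e (x : nform) : bool :=
  if x is Syl k f _ then (k == 1) && (f == e) else false.

Fixpoint normal (x : nform) : Prop :=
  if x is Syl k e y then
    [/\ coset_rep e k = k, ~~ starts_with (bar e) y & normal y]
  else True.

(** Left multiplication by g: g k is r a with r the representative of its coset
and a in A_e, and a passes across e as theta e a. *)
Fixpoint act g (x : nform) : nform :=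
  match x with
  | Base k => Base (g * k)
  | Syl k e y =>
      Syl (coset_rep e (g * k)) e
        (act (theta e ((coset_rep e (g * k))^-1 * (g * k))) y)
  end.

(** Left multiplication by the stable letter e. *)
Definition edge_act e (x : nform) : nform :=
  if x is Syl k f y then
    if (k == 1) && (f == bar e) then y else Syl 1 e x
  else Syl 1 e x.

(** This keeps a syllable from becoming cancellable when an element of the
associated subgroup is pushed into the rest of the normal form. *)
Lemma starts_with_act e a x : normal x -> A e a ->
  starts_with e (act a x) = starts_with e x.
Proof.
case: x => [//|k f y] /= [ck _ _] Aa.
have [fe|] := eqVneq f e; last by rewrite !andbF.
subst f; rewrite !andbT -[in RHS]ck; apply/eqP/eqP => /coset_rep_eq1 h.
  apply/coset_rep_eq1; rewrite -(mulKg a k); apply: assocM h; exact: assocV.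
by apply/coset_rep_eq1; exact: assocM.
Qed.

Lemma normal_act g x : normal x -> normal (act g x).
Proof.
elim: x g => [//|k e y IH] g /= [ck ny vy].
have Ar := coset_rep_mem e (g * k).
split; last exact: IH.
  by have := coset_rep_idem_mul e 1 (g * k); rewrite !mul1g.
by rewrite starts_with_act//; exact: assoc_iso_mem.
Qed.

Lemma act1 x : normal x -> act 1 x = x.
Proof.
elim: x => [k _|k e y IH] /=; first by rewrite mul1g.
by case=> ck _ vy; rewrite mul1g ck mulVg assoc_iso1 IH.
Qed.

Lemma actM g h x : normal x -> act (g * h) x = act g (act h x).
Proof.
elim: x g h => [k|k e y IH] g h /=; first by rewrite mulgA.
case=> _ _ vy; rewrite coset_rep_idem_mul -(mulgA g h k); congr Syl.
have Ahk := coset_rep_mem e (h * k).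
have := coset_rep_mem e (g * coset_rep e (h * k)).
rewrite coset_rep_idem_mul => Aghk; rewrite -IH// -assoc_isoM//.
by rewrite -!mulgA mulVKg.
Qed.

Lemma edge_actE e x :
  ~~ starts_with (bar e) x -> edge_act e x = Syl 1 e x.
Proof. by case: x => [//|k f y] /= /negbTE ->. Qed.

Lemma normal_edge_act e x : normal x -> normal (edge_act e x).
Proof.
have [|nx vx] := boolP (starts_with (bar e) x).
  by case: x => //= k f y -> [].
by rewrite edge_actE//=; split=> //; apply/coset_rep_eq1; exact: assoc1.
Qed.

Lemma edge_actK e x : normal x -> edge_act e (edge_act (bar e) x) = x.
Proof.
have [|nx vx] := boolP (starts_with (bar (bar e)) x).
  case: x => //= k f y /[dup] /andP[/eqP -> /eqP ->] -> [_ ny _].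
  by rewrite !(barK H) in ny *; rewrite edge_actE.
by rewrite (edge_actE nx)/= !eqxx.
Qed.

Lemma edge_actVK e x : normal x -> edge_act (bar e) (edge_act e x) = x.
Proof. by move=> /(edge_actK (bar e)); rewrite barK. Qed.

(** The relation a e = e (theta e a), checked on normal forms. Both sides
cancel the same initial syllable or neither does. *)
Lemma edge_act_theta e a x : normal x -> A e a ->
  edge_act e (act (theta e a) x) = act a (edge_act e x).
Proof.
move=> vx Aa; have Ata := assoc_iso_mem Aa.
have [|nx] := boolP (starts_with (bar e) x).
  case: x vx => //= k f y _ /[dup] /andP[/eqP -> /eqP ->] ->.
  rewrite mulg1; have /coset_rep_eq1 -> := Ata.
  by rewrite !eqxx invg1 mul1g assoc_isoK.
rewrite !edge_actE ?starts_with_act//= mulg1.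
by have /coset_rep_eq1 -> := Aa; rewrite invg1 mul1g.
Qed.

End NormalForms.

(** * The action of the path group on normal forms *)

Section Ambient.
Variable GG : graph_of_groups.
Implicit Types (v u : vertex GG) (e : edge GG).

Definition vprod : Type := forall v : vertex GG, vgroup v.

HB.instance Definition _ := gen_eqMixin vprod.
HB.instance Definition _ := gen_choiceMixin vprod.

Definition vprod_one : vprod := fun=> 1.
Definition vprod_mul (x y : vprod) : vprod := fun v => x v * y v.
Definition vprod_inv (x : vprod) : vprod := fun v => (x v)^-1.

Lemma vprod_mulA : associative vprod_mul.
Proof.
move=> x y z; apply: functional_extensionality_dep => v; exact: mulgA.
Qed.

Lemma vprod_mul1 : left_id vprod_one vprod_mul.
Proof.
move=> x; apply: functional_extensionality_dep => v; exact: mul1g.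
Qed.

Lemma vprod_mul1r : right_id vprod_one vprod_mul.
Proof.
move=> x; apply: functional_extensionality_dep => v; exact: mulg1.
Qed.

Lemma vprod_mulV : left_inverse vprod_one vprod_inv vprod_mul.
Proof.
move=> x; apply: functional_extensionality_dep => v; exact: mulVg.
Qed.

Lemma vprod_mulVr : right_inverse vprod_one vprod_inv vprod_mul.
Proof.
move=> x; apply: functional_extensionality_dep => v; exact: mulgV.
Qed.

HB.instance Definition _ := isGroup.Build vprod
  vprod_mulA vprod_mul1 vprod_mul1r vprod_mulV vprod_mulVr.

Definition incl v (g : vgroup v) : vprod := dfwith (fun u => 1 : vgroup u) g.

Lemma incl_inj v : injective (@incl v).
Proof. by move=> g h /(congr1 (@^~ v)); rewrite /incl !dfwith_in. Qed.

Lemma inclM v (g h : vgroup v) : incl (g * h) = incl g * incl h.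
Proof.
apply: functional_extensionality_dep => u.
have -> : (incl g * incl h) u = incl g u * incl h u by [].
rewrite /incl; have [vu|vu] := eqVneq v u; last by rewrite !dfwith_out// mulg1.
by subst u; rewrite !dfwith_in.
Qed.

Lemma incl1 v : incl (1 : vgroup v) = 1.
Proof. by apply: (mulgI (incl (1 : vgroup v))); rewrite -inclM !mulg1. Qed.

Lemma inclV v (g : vgroup v) : incl g^-1 = (incl g)^-1.
Proof. by apply: (mulgI (incl g)); rewrite mulgV -inclM mulgV incl1. Qed.

Definition edge_sub e : set vprod :=
  [set incl (emb e h) | h in [set: egroup e]].

Lemma edge_sub_incl e (g : vgroup (org e)) :
  edge_sub e (incl g) <-> range (emb e) g.
Proof.
by split=> [[h _ /incl_inj <-]|[h _ <-]]; exists h.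
Qed.

(** The isomorphism between the two images of G_e in the product; [1] is the
default value outside the subgroup. *)
Definition transfer e (k : vprod) : vprod :=
  incl (emb (rev_edge e)
         (egroup_cast (xget 1 [set h : egroup e | incl (emb e h) = k]))).

Lemma transferE e (h : egroup e) :
  transfer e (incl (emb e h)) = incl (emb (rev_edge e) (egroup_cast h)).
Proof.
rewrite /transfer (@xget_unique _ _ _ h)// => h' /incl_inj.
exact: emb_inj.
Qed.

Lemma edge_sub1 e : edge_sub e 1.
Proof. by exists 1 => //; rewrite gmulf1 incl1. Qed.

Lemma edge_subM e a b : edge_sub e a -> edge_sub e b -> edge_sub e (a * b).
Proof.
by move=> [g _ <-] [h _ <-]; exists (g * h) => //; rewrite gmulfM inclM.
Qed.

Lemma edge_subV e a : edge_sub e a -> edge_sub e a^-1.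
Proof. by move=> [g _ <-]; exists g^-1 => //; rewrite gmulfV inclV. Qed.

Lemma transfer_sub e a : edge_sub e a -> edge_sub (rev_edge e) (transfer e a).
Proof. by move=> [g _ <-]; rewrite transferE; exists (egroup_cast g). Qed.

Lemma eq_rect_groupM (G H : groupType) (p : G = H) (x y : H) :
  eq_rect_r (fun L : groupType => L : Type) (x * y) p =
  eq_rect_r (fun L : groupType => L : Type) x p *
  eq_rect_r (fun L : groupType => L : Type) y p.
Proof. by subst H. Qed.

Lemma transferM e a b : edge_sub e a -> edge_sub e b ->
  transfer e (a * b) = transfer e a * transfer e b.
Proof.
move=> [g _ <-] [h _ <-]; rewrite -inclM -gmulfM !transferE -inclM -gmulfM.
by congr (incl (emb _ _)); exact: eq_rect_groupM.
Qed.

(** Casting along rev (rev e) = e is harmless, whichever proof of equality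
between the edge groups is used: such proofs are all equal. *)
Lemma incl_emb_cast e f (ef : f = e) (p : egroup f = egroup e)
    (h : egroup e) :
  incl (emb f (eq_rect_r (fun H : groupType => H : Type) h p)) =
  incl (emb e h).
Proof. by subst f; rewrite (Prop_irrelevance p erefl). Qed.

Lemma eq_rect_group_trans (G H L : groupType) (p : G = H) (q : H = L) (x : L) :
  eq_rect_r (fun M : groupType => M : Type)
    (eq_rect_r (fun M : groupType => M : Type) x q) p =
  eq_rect_r (fun M : groupType => M : Type) x (etrans p q).
Proof. by subst H; subst L. Qed.

Lemma transferK e a : edge_sub e a -> transfer (rev_edge e) (transfer e a) = a.
Proof.
move=> [g _ <-]; rewrite !transferE /egroup_cast eq_rect_group_trans.
by apply: incl_emb_cast; exact: rev_edgeK.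
Qed.

Definition ambient_hnn : hnn_data vprod (edge GG) :=
  HnnData (@rev_edgeK GG) edge_sub1 edge_subM edge_subV
    transfer_sub transferM transferK.

Local Notation nform := (nform vprod (edge GG)).
Local Notation normal := (normal ambient_hnn).
Local Notation act := (act ambient_hnn).
Local Notation edge_act := (edge_act ambient_hnn).

Definition gen_act (x : generator GG) : nform -> nform :=
  match x with VGen _ g => act (incl g) | EGen e => edge_act e end.

Definition word_act (w : word GG) (z : nform) : nform := foldr gen_act z w.

Lemma normal_word_act w z : normal z -> normal (word_act w z).
Proof.
move=> nz; elim: w => //= -[v g|e] w IH /=; first exact: normal_act.
exact: normal_edge_act.
Qed.

(** The action respects the defining relations, hence descends to the path
group. *)
Lemma word_act_eqv w1 w2 z :
  word_eqv w1 w2 -> normal z -> word_act w1 z = word_act w2 z.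
Proof.
move=> ww; elim: ww z => {w1 w2} [//|w1 w2 _ IH z nz|w1 w2 w3 _ IH1 _ IH2 z nz
  |w1 w1' w2 w2' _ IH1 _ IH2 z nz|v z nz|v g h z nz|e z nz|e g z nz].
- by rewrite IH.
- by rewrite IH1// IH2.
- rewrite /word_act !foldr_cat -!/(word_act _ _) IH2// IH1//.
  exact: normal_word_act.
- by rewrite /= incl1 (act1 nz).
- by rewrite /= inclM (actM _ _ nz).
- exact: (edge_actK e nz).
- have Ag : edge_sub e (incl (emb e g)) by exists g.
  rewrite /= -transferE -(edge_act_theta (H := ambient_hnn) nz Ag).
  by apply: (edge_actVK (H := ambient_hnn)); exact: normal_act.
Qed.

Definition path_act (x : path_group GG) : nform -> nform := word_act (repr x).

Lemma normal_path_act x z : normal z -> normal (path_act x z).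
Proof. exact: normal_word_act. Qed.

Lemma path_act_class w z : normal z -> path_act (path_class w) z = word_act w z.
Proof. exact/word_act_eqv/repr_path_class. Qed.

Lemma path_actM x y z : normal z ->
  path_act (x * y) z = path_act x (path_act y z).
Proof.
by move=> nz; rewrite [LHS]path_act_class// /word_act foldr_cat.
Qed.

Lemma path_act_vtx v (g : vgroup v) z :
  normal z -> path_act (vtx g) z = act (incl g) z.
Proof. exact: path_act_class. Qed.

Lemma path_act_edg e z : normal z -> path_act (edg e) z = edge_act e z.
Proof. exact: path_act_class. Qed.

Local Notation item := {e : edge GG & vgroup (org e)}.

Definition syllable e (g : vgroup (org e)) : item :=
  Tagged (fun f => vgroup (org f)) g.

Definition path_prod (s : seq item) : path_group GG :=
  \prod_(p <- s) (vtx (tagged p) * edg (tag p)).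

(** The subpath e g (rev e) with g in the image of the edge group, which equals
an element of the vertex group o(e). *)
Definition cancels (p q : item) : bool :=
  (tag q == rev_edge (tag p)) && `[< range (emb (tag q)) (tagged q) >].

Definition reduced (s : seq item) : bool :=
  sorted (fun p q => ~~ cancels p q) s.

Lemma path_prod_cons p s :
  path_prod (p :: s) = vtx (tagged p) * edg (tag p) * path_prod s.
Proof. exact: big_cons. Qed.

Lemma path_prod_rcons s p :
  path_prod (rcons s p) = path_prod s * (vtx (tagged p) * edg (tag p)).
Proof. by rewrite /path_prod -cats1 big_cat big_seq1. Qed.

(** No cancellation ever happens when the syllables are multiplied on one after
the other, starting from the last: if e_1 cancelled e_2 then e_2 = rev e_1 and
the representative of the coset of g_2 would be 1, so that [cancels] holds. *)
Lemma reduced_act p s k : reduced (p :: s) -> exists y,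
  path_act (path_prod (p :: s)) (Base _ k) =
  Syl (coset_rep ambient_hnn (tag p) (incl (tagged p))) (tag p) y.
Proof.
elim: s p => [|q s IH] p.
  move=> _; rewrite /path_prod big_seq1 path_actM// path_act_edg//.
  rewrite path_act_vtx; last exact: (@normal_edge_act _ _ ambient_hnn).
  by rewrite /= mulg1; eexists.
move=> /= /andP[npq /IH[y qs]].
have nq : normal (path_act (path_prod (q :: s)) (Base _ k)).
  exact: normal_path_act.
rewrite path_prod_cons !path_actM// qs; rewrite qs in nq.
rewrite (path_act_edg _ nq) path_act_vtx; last exact: normal_edge_act nq.
rewrite edge_actE; first by rewrite /= mulg1; eexists.
apply: contra npq => /= /andP[/eqP /coset_rep_eq1 Aq /eqP tq].
by apply/andP; split; [exact/eqP|exact/asboolP/edge_sub_incl].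
Qed.

(** The path rev(e) g^-1 g_1 e_1 ... is reduced, so it sends a base normal form
to one that begins with rev e. The hypothesis on the first syllable is stated in
the product of the vertex groups, where no cast along tag p = e is needed. *)
Lemma conj_path_not_vtx e (g : vgroup (org e)) p s u (h : vgroup u) :
  reduced (p :: s) ->
  (tag p = e -> ~ edge_sub e (incl g^-1 * incl (tagged p))) ->
  (vtx g * edg e)^-1 * path_prod (p :: s) <> vtx h.
Proof.
move=> /(@reduced_act _ _ 1)[y ps] pe.
move=> /(congr1 (fun x => path_act x (Base _ 1))).
rewrite path_act_vtx// path_actM// ps invgM -edgV -vtxV.
have nps : normal (path_act (path_prod (p :: s)) (Base _ 1)).
  exact: normal_path_act.
rewrite ps in nps; rewrite path_actM// path_act_vtx//.
rewrite path_act_edg; last exact: normal_act.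
rewrite edge_actE//=; apply/negP => /andP[/eqP].
rewrite coset_rep_idem_mul rev_edgeK inclV => /coset_rep_eq1 Ap /eqP pf.
by apply: (pe pf); move: (incl (tagged p)) Ap => k; rewrite pf inclV.
Qed.

End Ambient.

(** * Reduced paths and their conjugates *)

Section ReducedForms.
Variable GG : graph_of_groups.
Implicit Types (v u : vertex GG) (e : edge GG).

Definition reduced_form v u (x : path_group GG) : Prop :=
  exists s (h : vgroup u), [/\ edge_path v u [seq tag p | p <- s],
    reduced s & x = path_prod s * vtx h].

Lemma reduced_form_vtxl v u (g : vgroup v) x :
  reduced_form v u x -> reduced_form v u (vtx g * x).
Proof.
move=> [[|[e k] s] [h [/= pth red ->]]].
  move: pth g h => /eqP-> g h; exists [::], (g * h); split=> //=.
  by rewrite vtxM /path_prod big_nil !mul1g.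
case/andP: pth => /eqP ev pth; subst v.
exists (syllable (g * k) :: s), h; split=> //=.
- by rewrite eqxx.
- by case: s red {pth}.
- by rewrite !path_prod_cons /= vtxM !mulgA.
Qed.

(** The edge relation for rev e, with rev (rev e) replaced by e; the element k'
is left abstract because its type depends on that equation. *)
Lemma edg_backtrack e (k : egroup (rev_edge e)) :
  exists k' : egroup e,
    edg e * vtx (emb (rev_edge e) k) * edg (rev_edge e) = vtx (emb e k').
Proof.
have := edg_rel k; move: (egroup_cast k); rewrite rev_edgeK => k' kk'.
by exists k'.
Qed.

(** Only the first two syllables can cancel when one is prepended to a reduced
path, and the vertex element that results is absorbed into what remains. *)
Lemma path_set_reduced v u x : path_set v u x -> reduced_form v u x.
Proof.
move=> px.
elim/path_set_ind: v u x / px => [v g|e u g x _ [s [h [pth red ->]]]].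
  by exists [::], g; split=> //=; rewrite /path_prod big_nil mul1g.
rewrite -mulgA; apply: reduced_form_vtxl.
pose p := syllable (1 : vgroup (org e)).
have [redp|nredp] := boolP (reduced (p :: s)).
  exists (p :: s), h.
  by split=> //=; [rewrite eqxx|rewrite path_prod_cons /= vtx1 mul1g mulgA].
case: s pth red nredp => [//|[f k] s] /= /andP[_ pth] red.
rewrite [path _ _ _]red andbT negbK => /andP[/= /eqP fe /asboolP[k' _ kk']].
subst f; rewrite path_prod_cons /= -kk' !mulgA.
have [k1 ->] := edg_backtrack k'; rewrite -mulgA; apply: reduced_form_vtxl.
exists s, h; split=> //; last exact: path_sorted red.
by rewrite org_rev.
Qed.

(** D consists of the last vertex element of a reduced path for x and, if that
path begins with the edge e, of the inverse of its first vertex element. If g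
satisfies the two conditions then the conjugate by g e is reduced. *)
Lemma finite_conj_obstruction e (x : path_group GG) :
  path_set (org e) (org e) x -> x <> 1 ->
  exists2 D : set (vgroup (org e)), finite_set D &
    forall g, (forall d, D d -> ~ range (emb e) (d * g)) ->
      (forall d, D d -> d <> 1 -> ~ range (emb e) (g^-1 * d * g)) ->
      forall u (h : vgroup u),
        (vtx g * edg e)^-1 * x * (vtx g * edg e) <> vtx h.
Proof.
move=> /path_set_reduced[s [k [_ red ->]]] x1.
have [D' finD' D's] : exists2 D' : set (vgroup (org e)), finite_set D' &
    if s is p :: _ then
      tag p = e -> exists2 d, D' d & incl d = (incl (tagged p))^-1
    else True.
  case: s {red x1} => [|[f m] s]; first by exists set0.
  have [fe|fe] := pselect (f = e); last by exists set0.
  by subst f; exists [set m^-1] => // _; exists m^-1 => //; rewrite inclV.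
exists ([set k] `|` D'); first by rewrite finite_setU.
move=> g Dg gDg u h.
(* The right-hand factor g e extends the path by one syllable. *)
pose q := syllable (k * g).
have -> : (vtx g * edg e)^-1 * (path_prod s * vtx k) * (vtx g * edg e) =
    (vtx g * edg e)^-1 * path_prod (rcons s q).
  by rewrite path_prod_rcons /= vtxM !mulgA.
case: s red x1 D's => [_ x1 _|p s red _ D's].
  apply: conj_path_not_vtx => //= _.
  rewrite -inclM edge_sub_incl mulgA.
  apply: gDg => [|k1]; first by left.
  by apply: x1; rewrite k1 vtx1 /path_prod big_nil mulg1.
apply: conj_path_not_vtx.
  have := red; rewrite /reduced /= rcons_path => ->/=.
  by apply/negP => /andP[_ /asboolP]; apply: Dg; left.
move=> /D's[d D'd dp] /edge_subV; rewrite invgM inclV invgK -dp -inclM.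
by move=> /edge_sub_incl; apply: Dg; right.
Qed.

End ReducedForms.

Lemma connected_path_set (GG : graph_of_groups) (v u : vertex GG) :
  exists x, path_set v u x.
Proof.
have [s] := @base_connected GG v u.
elim: s v => [v /= /eqP ->|f s IH v /= /andP[/eqP <- /IH[x xp]]].
  by exists 1; exact: path_set1.
by exists (vtx (1 : vgroup (org f)) * edg f * x); exact: path_set_cons.
Qed.

Theorem proposition4p2 (GG : graph_of_groups)
    (Sigma : forall e : edge GG, set (vgroup (org e)))
    (HSigma : forall e : edge GG, edge_transversal (Sigma e))
    (v : vertex GG) (e : edge GG)
    (Hinf : infinite_set (Sigma e))
    (Htwo : (`I_2 #<= Sigma (rev_edge e))%card)
    (Hfin : forall F E : set (vgroup (org e)),
      finite_set F -> finite_set E -> E `<=` Sigma e ->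
      exists g : vgroup (org e),
        [/\ (Sigma e `\` E) g,
            [set f * g | f in F] `&` range (emb e) = set0 &
            [set g^-1 * f * g | f in F `\ 1] `&` range (emb e) = set0]) :
  strongly_faithful (bs_action v).
Proof.
move=> F finF F1.
have [c cp] := connected_path_set v (org e).
pose conj (f : pi1 v) := c^-1 * val f * c.
have /choice[D Dprop] (f : pi1 v) : exists D : set (vgroup (org e)),
    finite_set D /\ (F f -> forall g,
      (forall d, D d -> ~ range (emb e) (d * g)) ->
      (forall d, D d -> d <> 1 -> ~ range (emb e) (g^-1 * d * g)) ->
      forall u (h : vgroup u),
        (vtx g * edg e)^-1 * conj f * (vtx g * edg e) <> vtx h).
  have [Ff|nFf] := pselect (F f); last by exists set0; split.
  have pf : path_set v v (val f) by have := valP f; rewrite inE.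
  have [||D finD DP] := @finite_conj_obstruction GG e (conj f).
  - exact: path_setM (path_setM (path_setV cp) pf) cp.
  - move=> cf1; apply: (F1 _ Ff); apply: val_inj.
    apply: (mulgI c^-1); apply: (mulIg c); rewrite -[LHS]/(conj f) cf1.
    by rewrite /= mulg1 mulVg.
  - by exists D.
have [g [_ Fg gFg]] := Hfin (\bigcup_(f in F) D f) set0
  (bigcup_finite finF (fun f _ => (Dprop f).1)) (finite_set0 _) (sub0set _).
have px : path_set v (tgt e) (c * (vtx g * edg e)).
  apply: path_setM cp _; rewrite -[_ * _]mulg1.
  exact/path_set_cons/path_set1.
exists (BSVertex (ex_intro2 _ _ _ px erefl)) => f Ff.
move=> /(congr1 (@bs_coset _ _)) /=; rewrite vtx_cosetM => fixf.
have : vtx_coset (tgt e) (c * (vtx g * edg e)) (val f * (c * (vtx g * edg e))).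
  by rewrite -fixf; exists 1 => //; rewrite vtx1 mulg1.
case=> h _ hE; apply: ((Dprop f).2 Ff g _ _ _ h).
- move=> d Dd rd; suff : set0 (d * g) by [].
  by rewrite -Fg; split=> //; exists d => //; exists f.
- move=> d Dd d1 rd; suff : set0 (g^-1 * d * g) by [].
  by rewrite -gFg; split=> //; exists d => //; split=> //; exists f.
- move: hE; move: (vtx g * edg e) => w hE.
  by apply: (mulgI (c * w)); rewrite hE /conj !mulgA mulgK mulgV mul1g.
Qed.
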